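(* Let $\mathcal{H}$ be a complex separable Hilbert space, let $\mathcal{K}$ and $\mathcal{E}$ be complex Krein spaces, let $T:\mathcal{H}\to\mathcal{K}$ and $V:\mathcal{H}\to\mathcal{E}$ be bounded surjective linear operators such that $V^\#V$ is indefinite, and let $\rho\in\mathbb{R}$, $\rho\neq 0$. Given $z_0\in\mathcal{E}$, the minimum $$\min_{x\in\mathcal{H}}\left([Tx,Tx]_{\mathcal{K}}+\rho\,[Vx-z_0,Vx-z_0]_{\mathcal{E}}\right)$$ exists (i.e. the infimum is attained at some $x\in\mathcal{H}$) if and only if $T^\#T+\rho V^\#V\in\mathcal{L}(\mathcal{H})^+$ and $V^\#z_0\in R(T^\#T+\rho V^\#V)$.
   Context: A Krein space is a complex vector space $\mathcal{F}$ with a Hermitian sesquilinear form $[\cdot,\cdot]_{\mathcal{F}}$ that admits a fundamental decomposition $\mathcal{F}=\mathcal{F}_+\dotplus\mathcal{F}_-$, where $\mathcal{F}_+$ and $\mathcal{F}_-$ are orthogonal with respect to $[\cdot,\cdot]_{\mathcal{F}}$ and $(\mathcal{F}_+,[\cdot,\cdot])$, $(\mathcal{F}_-,-[\cdot,\cdot])$ are Hilbert spaces. Topological notions refer to the norm of the Hilbert space direct sum of these two spaces (the topology does not depend on the decomposition). For a bounded operator $T:\mathcal{H}\to\mathcal{K}$ from the Hilbert space $(\mathcal{H},\langle\cdot,\cdot\rangle)$ to the Krein space $\mathcal{K}$, $T^\#:\mathcal{K}\to\mathcal{H}$ is the bounded operator with $[Tx,y]_{\mathcal{K}}=\langle x,T^\#y\rangle$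 for all $x,y$; $V^\#$ is defined similarly. $\mathcal{L}(\mathcal{H})^+$ is the set of bounded positive semidefinite operators on $\mathcal{H}$. $V^\#V$ is indefinite if it is neither positive nor negative semidefinite. $R(\cdot)$ denotes the range. *)

(* Defs.v *)
From HB Require Import structures.
From mathcomp Require Import all_boot all_order all_algebra.
From mathcomp Require Import complex.
From mathcomp Require Import all_classical all_reals all_analysis.

Set Implicit Arguments.
Unset Strict Implicit.
Unset Printing Implicit Defensive.

Import Order.TTheory GRing.Theory Num.Theory.
Import numFieldNormedType.Exports.

Local Open Scope classical_set_scope.
Local Open Scope ring_scope.

(* The complex numbers are R[i], for R : realType.  On R[i], x <= y means that
   x and y have the same imaginary part and ordered real parts; in particular
   0 <= x entails that x is real.  Forms are linear in their first argument and
   conjugate-linear in the second one. *)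

Record hilbertSpace (R : realType) := HilbertSpace {
  hcarrier :> completeNormedModType R[i];
  inner : {dot hcarrier for Num.conj};
  inner_norm : forall x : hcarrier, `|x| ^+ 2 = inner x x
}.

Definition separable (X : topologicalType) :=
  exists D : set X, countable D /\ dense D.

(* (S, f) is a Hilbert space: S is the image of a Hilbert space under a linear
   injection that carries its inner product to f. *)
Definition hilbert_subspace (R : realType) (F : lmodType R[i])
    (f : F -> F -> R[i]) (S : set F) :=
  exists (G : hilbertSpace R) (j : {linear G -> F}),
    [/\ injective j, range j = S & forall x y, f (j x) (j y) = inner G x y].

Definition fundamental_decomposition (R : realType) (F : lmodType R[i])
    (f : F -> F -> R[i]) (Fp Fm : set F) :=
  [/\ hilbert_subspace f Fp,
      hilbert_subspace (fun x y => - f x y) Fm,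
      (forall p m, Fp p -> Fm m -> f p m = 0),
      (forall x, exists p m, [/\ Fp p, Fm m & x = p + m])
    & Fp `&` Fm = [set 0] ].

Record kreinSpace (R : realType) := KreinSpace {
  kcarrier :> lmodType R[i];
  kform : {hermitian_sym kcarrier for Num.conj};
  krein_decomposable : exists D : set kcarrier * set kcarrier,
    fundamental_decomposition kform D.1 D.2
}.

Section KreinNorm.
Variables (R : realType) (K : kreinSpace R).

Definition krein_decomp : set K * set K := sval (cid (krein_decomposable K)).

Definition krein_pos (x : K) : K :=
  xget 0 [set p | krein_decomp.1 p /\ krein_decomp.2 (x - p)].

Definition krein_neg (x : K) : K := x - krein_pos x.

(* The norm of the Hilbert space direct sum F_+ (+) F_-, for a decomposition
   picked by choice: all fundamental decompositions yield equivalent norms. *)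
Definition krein_norm (x : K) : R[i] :=
  sqrtC (kform K (krein_pos x) (krein_pos x) - kform K (krein_neg x) (krein_neg x)).

End KreinNorm.

Definition bounded_operator (R : realType) (U V : lmodType R[i])
    (normU : U -> R[i]) (normV : V -> R[i]) (A : U -> V) :=
  linear A /\ exists M : R, forall x, normV (A x) <= M%:C%C * normU x.

Section Operators.
Variables (R : realType) (H : hilbertSpace R).

Definition bounded_to_krein (K : kreinSpace R) (T : H -> K) :=
  bounded_operator (fun x : H => `|x|) (@krein_norm R K) T.

Definition is_krein_adjoint (K : kreinSpace R) (T : H -> K) (S : K -> H) :=
  bounded_operator (@krein_norm R K) (fun x : H => `|x|) S /\
  forall x y, kform K (T x) y = inner H x (S y).

(* T^#.  It exists and is unique for bounded T; the default value 0 is only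
   used for other T. *)
Definition krein_adjoint (K : kreinSpace R) (T : H -> K) : K -> H :=
  xget (fun=> 0) [set S | is_krein_adjoint T S].

Definition positive_semidefinite (A : H -> H) :=
  forall x, 0 <= inner H (A x) x.

Definition negative_semidefinite (A : H -> H) :=
  forall x, inner H (A x) x <= 0.

Definition indefinite (A : H -> H) :=
  ~ positive_semidefinite A /\ ~ negative_semidefinite A.

(* Membership in L(H)^+ *)
Definition bounded_positive (A : H -> H) :=
  bounded_operator (fun x : H => `|x|) (fun x : H => `|x|) A /\
  positive_semidefinite A.

End Operators.

(* Main.v *)
(* The adjoints T^# and V^# exist by the Riesz representation theorem, because
   the Krein norm dominates the indefinite form (Cauchy-Schwarz on each summand
   of a fundamental decomposition).  With A = T^#T + rho V^#V and w = V^# z0,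
     J (x + h) = J x + 2 Re <A x - rho w, h> + <A h, h>,
   so x0 is a minimiser if and only if A is positive semidefinite and
   A x0 = rho w; as rho != 0, such an x0 exists if and only if w is in the range
   of A. *)
Require Import Defs.
From HB Require Import structures.
From mathcomp Require Import all_boot all_order all_algebra.
From mathcomp Require Import complex.
From mathcomp Require Import all_classical all_reals all_analysis.
From mathcomp Require Import ring lra.

Set Implicit Arguments.
Unset Strict Implicit.
Unset Printing Implicit Defensive.

Import Order.TTheory GRing.Theory Num.Theory.
Import numFieldNormedType.Exports.

Local Open Scope classical_set_scope.
Local Open Scope ring_scope.

(** This turns minimality along a line into first- and second-order conditions. Adding the values at
    1 and -1 gives the sign of [c]; the value at 1 then makes [b] real. *)
Lemma real_quadratic_ge0 (F : numFieldType) (b c : F) :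
    (forall t, t \is Num.real -> 0 <= t * b + t ^+ 2 * c) ->
  0 <= c /\ b = 0.
Proof.
move=> q_ge0.
have q1 := q_ge0 1 (real1 F).
have qN1 : 0 <= -1 * b + (-1) ^+ 2 * c by rewrite q_ge0// realN real1.
have c_ge0 : 0 <= c.
  have := addr_ge0 q1 qN1.
  rewrite sqrrN expr1n !mul1r mulN1r.
  have -> : b + c + (- b + c) = c *+ 2 by rewrite mulr2n; ring.
  by rewrite pmulrn_lge0.
split=> //.
have b_real : b \is Num.real.
  have -> : b = (1 * b + 1 ^+ 2 * c) - c by ring.
  by rewrite realB// ger0_real.
have c1_gt0 : 0 < c + 1 by rewrite ltr_wpDl.
(* Dividing by [c + 1] rather than [c] covers [c = 0]; the value at this point is minus a square. *)
have := q_ge0 (- (b / (c + 1))).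
have -> : - (b / (c + 1)) * b + (- (b / (c + 1))) ^+ 2 * c =
    - (b / (c + 1)) ^+ 2.
  by field; rewrite gt_eqF.
have r_real : b / (c + 1) \is Num.real by rewrite realM// realV gtr0_real.
rewrite realN r_real oppr_ge0 => /(_ isT) r_le0.
move: r_le0; rewrite real_exprn_even_le0// mulf_eq0 invr_eq0 (gt_eqF c1_gt0).
by rewrite orbF => /eqP.
Qed.

(** * The Cauchy-Schwarz inequality *)

Section InnerProduct.
Variables (C : numClosedFieldType) (U : lmodType C).
Variable f : {dot U for Num.conj}.

Lemma dot_cauchy_schwarz (u v : U) : `|f u v| ^+ 2 <= f u u * f v v.
Proof.
have [->|v_neq0] := eqVneq v 0.
  by rewrite !linear0r normr0 expr0n.
have fv_gt0 : 0 < f v v by rewrite dnorm_gt0.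
(* [a *: v] is the orthogonal projection of [u] on the line of [v]; Pythagoras for [u = w + a *: v]
   gives the bound. *)
pose a := f u v / f v v; pose w := u - a *: v.
have fwv : f w v = 0.
  by rewrite linearBl/= linearZl_LR/= divfK ?subrr// gt_eqF.
have -> : u = w + a *: v by rewrite subrK.
rewrite linearDl/= linearZl_LR/= fwv add0r.
have fwav : f w (a *: v) = 0 by rewrite linearZr_LR/= fwv mulr0.
rewrite dnormD fwav conjC0 !addr0.
rewrite dnormZ normrM (ger0_norm (ltW fv_gt0)) mulrDl exprMn.
rewrite -[X in _ + X]mulrA -expr2.
by rewrite lerDr mulr_ge0// ltW.
Qed.

End InnerProduct.

(** * The Riesz representation theorem, by minimisation *)

Section RieszRepresentation.
Variables (R : realType) (H : hilbertSpace R).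

Lemma inner_le (x y : H) : `|inner H x y| <= `|x| * `|y|.
Proof.
rewrite -(@ler_pXn2r _ 2)// ?nnegrE ?mulr_ge0//.
by rewrite exprMn !inner_norm dot_cauchy_schwarz.
Qed.

Lemma inner_cancel (x y : H) : (forall z, inner H z x = inner H z y) -> x = y.
Proof.
move=> eqxy; apply/eqP; rewrite -subr_eq0 -(dnorm_eq0 (inner H)).
by rewrite linearBr/= eqxy subrr.
Qed.

(** The variational argument runs in the underlying real inner product space, where values lie in
    [R] and infima exist. *)
Let N (x : H) : R := complex.Re `|x|.
Let g (x y : H) : R := complex.Re (inner H x y).

Let NE (x : H) : (N x)%:C%C = `|x|.
Proof. by rewrite RRe_real// ger0_real. Qed.

Let N_ge0 (x : H) : 0 <= N x.
Proof. by rewrite -ler0c NE. Qed.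

Let NxxE (x : H) : N x ^+ 2 = g x x.
Proof. by rewrite /g -inner_norm -NE -rmorphXn. Qed.

Let N_sqrD (x y : H) : N (x + y) ^+ 2 = N x ^+ 2 + 2 * g x y + N y ^+ 2.
Proof.
rewrite !NxxE /g dnormD !raddfD/=.
have -> : complex.Re (inner H x y)^* = complex.Re (inner H x y).
  by case: (inner H x y).
ring.
Qed.

Let g_scaler (t : R) (x y : H) : g x (t%:C%C *: y) = t * g x y.
Proof.
rewrite /g linearZr_LR/= (CrealP _) ?complex_real//.
by case: (inner H x y) => a b /=; rewrite mul0r subr0.
Qed.

Let g_le (x y : H) : g x y <= N x * N y.
Proof.
rewrite -lecR rmorphM/= !NE (le_trans _ (inner_le x y))//.
by rewrite (le_trans _ (normc_ge_Re _))// lecR ler_norm.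
Qed.

(* The representing vector minimises |x|^2 - 2 Re (phi x). *)
Theorem riesz_representation (phi : H -> R[i]) (M : R) :
    scalar phi -> (forall x, `|phi x| <= M%:C%C * `|x|) ->
  exists y, forall x, phi x = inner H x y.
Proof.
move=> phi_lin phi_le.
have phiD x y : phi (x + y) = phi x + phi y.
  by have := phi_lin 1 x y; rewrite scale1r mul1r.
have phi0 : phi 0 = 0 by apply: (addrI (phi 0)); rewrite -phiD !addr0.
have phiZ a x : phi (a *: x) = a * phi x.
  by have := phi_lin a x 0; rewrite phi0 !addr0.
pose p x := complex.Re (phi x).
have pD x y : p (x + y) = p x + p y by rewrite /p phiD raddfD.
have pZ t x : p (t%:C%C *: x) = t * p x.
  by rewrite /p phiZ; case: (phi x) => a b /=; rewrite mul0r subr0.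
have pN x : p (- x) = - p x.
  by apply/eqP; rewrite -addr_eq0 -pD addNr /p phi0.
have p_le x : p x <= M * N x.
  rewrite -lecR rmorphM/= NE (le_trans _ (phi_le x))//.
  by rewrite (le_trans _ (normc_ge_Re _))// lecR ler_norm.
pose q x := N x ^+ 2 - 2 * p x.
have qD x y : q (x + y) = q x + 2 * (g x y - p y) + N y ^+ 2.
  by rewrite /q N_sqrD pD; ring.
pose m := inf (range q).
have q_inf : has_inf (range q).
  split; first by exists (q 0), 0.
  (* [q x] is at least [N x ^+ 2 - 2 * M * N x]; complete the square. *)
  exists (- M ^+ 2) => _ [x _ <-]; rewrite /q.
  by have := p_le x; have := sqr_ge0 (N x - M); nra.
have m_le x : m <= q x by apply: ge_inf; [case: q_inf|exists x].
pose S (d : R) := [set x | q x < m + d].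
(* Parallelogram law: the sets of almost minimisers shrink. *)
have S_close d x y : S d x -> S d y -> N (x - y) ^+ 2 < 4 * d.
  rewrite /S/= => qx qy.
  have := m_le ((2^-1)%:C%C *: (x + y)).
  rewrite /q pZ pD NxxE g_scaler.
  have -> : g ((2^-1)%:C%C *: (x + y)) (x + y) = 2^-1 * N (x + y) ^+ 2.
    rewrite NxxE /g linearZl_LR/=.
    by case: (inner H (x + y) (x + y)) => a b /=; rewrite mul0r subr0.
  rewrite !N_sqrD.
  have -> : g x (- y) = - g x y by rewrite /g linearNr raddfN.
  have -> : N (- y) = N y by rewrite /N normrN.
  by move: qx qy; rewrite /q; lra.
(* The sets of almost minimisers generate a Cauchy filter, which replaces a minimising sequence. *)
pose F := filter_from [set d : R | 0 < d] S.
have S_neq0 d : 0 < d -> S d !=set0.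
  move=> d_gt0; have [_ [x _ <-] qx] := inf_adherent d_gt0 q_inf.
  by exists x.
have FF : ProperFilter F.
  apply: filter_from_proper => //; apply: filter_from_filter.
    by exists 1; rewrite /= ltr01.
  move=> d e d_gt0 e_gt0; exists (Num.min d e); first by rewrite /= lt_min d_gt0.
  move=> x; rewrite /S/= => qx; split; rewrite (lt_le_trans qx)// lerD2l.
    by rewrite ge_min lexx.
  by rewrite ge_min lexx orbT.
have F_cauchy : cauchy F.
  apply: cauchy_exP => e e_gt0.
  have eE : (complex.Re e)%:C%C = e by rewrite RRe_real// gtr0_real.
  have Re_gt0 : 0 < complex.Re e by rewrite -ltcR eE.
  (* By [S_close], two points of [S (e ^+ 2 / 4)] are less than [e] apart. *)
  have d_gt0 : 0 < complex.Re e ^+ 2 / 4 by rewrite divr_gt0// exprn_gt0.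
  have [z Sz] := S_neq0 _ d_gt0.
  exists z, (complex.Re e ^+ 2 / 4) => // x Sx.
  rewrite -ball_normE/= -NE -eE ltcR.
  rewrite -(@ltr_pXn2r _ 2)// ?nnegrE//; last exact: ltW.
  by have := S_close _ _ _ Sz Sx; rewrite mulrC divfK.
have /cvg_ex[y Fy] : cvg F by exact: cauchy_cvg.
have q_near e : 0 < e -> exists2 x, q x < m + e & N (y - x) < e.
  move=> e_gt0.
  have e_gt0' : 0 < e%:C%C by rewrite ltcR.
  have [d d_gt0 Sd] : F (ball y e%:C%C) by apply: Fy; exact: nbhsx_ballx.
  have [|x] := S_neq0 (Num.min d e); first by rewrite lt_min d_gt0.
  rewrite /S/= => qx; exists x.
    by rewrite (lt_le_trans qx)// lerD2l ge_min lexx orbT.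
  rewrite -ltcR NE; have := Sd x; rewrite -ball_normE/=; apply.
  rewrite /S/= (lt_le_trans qx)// lerD2l.
  by rewrite ge_min lexx.
have q_min : q y <= m.
  apply/ler_addgt0Pr => e e_gt0.
  pose B := 1 + 2 * (N y + `|M|).
  have B_gt0 : 0 < B by rewrite /B; have := N_ge0 y; have := normr_ge0 M; lra.
  pose d := e / B.
  have [x qx yx] := q_near d (divr_gt0 e_gt0 B_gt0).
  pose z := y - x.
  have qxE : q x = q y - 2 * g y z + 2 * p z + N z ^+ 2.
    have -> : x = y - z by rewrite /z opprB addrC subrK.
    rewrite qD pN /N normrN -/(N z).
    have -> : g y (- z) = - g y z by rewrite /g linearNr raddfN.
    ring.
  have pz_le : - p z <= `|M| * N z.
    rewrite -pN (le_trans (p_le _))// /N normrN -/(N z).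
    by rewrite ler_wpM2r// ler_norm.
  have Bz_le : (B - 1) * N z <= (B - 1) * d.
    apply: ler_wpM2l; last exact: ltW.
    by rewrite /B addrC addKr mulr_ge0// addr_ge0.
  have eE : d + (B - 1) * d = e by rewrite /d; field; rewrite gt_eqF.
  have := g_le y z; have := sqr_ge0 (N z).
  by move: Bz_le eE; rewrite /B; clearbody d; lra.
(* First-order condition at the minimiser [y] in the direction [h]. *)
have ReE h : g y h = p h.
  have [|_ /eqP] := @real_quadratic_ge0 _ (2 * (g y h - p h)) (N h ^+ 2).
    move=> t _; have := le_trans q_min (m_le (y + t%:C%C *: h)).
    rewrite qD pZ g_scaler NxxE g_scaler.
    have -> : g (t%:C%C *: h) h = t * N h ^+ 2.
      rewrite NxxE /g linearZl_LR/=.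
      by case: (inner H h h) => a b /=; rewrite mul0r subr0.
    by lra.
  by rewrite mulf_eq0 pnatr_eq0/= subr_eq0 => /eqP.
have ReE' h : complex.Re (phi h) = complex.Re (inner H h y).
  rewrite -/(p h) -ReE /g hermC expr0 mul1r.
  by rewrite /=; case: (inner H h y).
(* The real part at ['i *: x] is minus the imaginary part at [x], so equal real parts everywhere
   give equality. *)
exists y => x; have := ReE' x; have := ReE' ('i%C *: x).
rewrite phiZ linearZl_LR/=.
case: (phi x) (inner H x y) => a b [c d] /=.
by rewrite !mul0r !mul1r !sub0r => /oppr_inj -> ->.
Qed.

End RieszRepresentation.

(** This glues the Cauchy-Schwarz inequalities of two orthogonal summands. After squaring, the cross
    term [2 |z| |w|] is at most [a d + b c], because [(a d + b c)^2 - 4 a d b c] is the square of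
    [a d - b c]. *)
Lemma cauchy_schwarz_add (C : numClosedFieldType) (a b c d z w : C) :
    0 <= a -> 0 <= b -> 0 <= c -> 0 <= d ->
    `|z| ^+ 2 <= a * c -> `|w| ^+ 2 <= b * d ->
  `|z + w| <= sqrtC (a + b) * sqrtC (c + d).
Proof.
move=> a_ge0 b_ge0 c_ge0 d_ge0 z_le w_le.
have ab_ge0 : 0 <= a + b by rewrite addr_ge0.
have cd_ge0 : 0 <= c + d by rewrite addr_ge0.
rewrite -(@ler_pXn2r _ 2)// ?nnegrE ?mulr_ge0 ?sqrtC_ge0//.
rewrite exprMn !sqrtCK.
apply: (@le_trans _ _ ((`|z| + `|w|) ^+ 2)).
  by rewrite ler_pXn2r ?nnegrE ?addr_ge0// ler_normD.
have ad_ge0 : 0 <= a * d by rewrite mulr_ge0.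
have bc_ge0 : 0 <= b * c by rewrite mulr_ge0.
have zw_le : (`|z| * `|w|) *+ 2 <= a * d + b * c.
  rewrite -(@ler_pXn2r _ 2)// ?nnegrE ?mulrn_wge0 ?addr_ge0 ?mulr_ge0//.
  have zw2_le : (`|z| * `|w|) ^+ 2 <= (a * d) * (b * c).
    have -> : (a * d) * (b * c) = (a * c) * (b * d) by ring.
    by rewrite exprMn ler_pM ?exprn_ge0.
  have -> : (`|z| * `|w| *+ 2) ^+ 2 = (`|z| * `|w|) ^+ 2 *+ 4.
    by rewrite exprMn_n.
  apply: (@le_trans _ _ ((a * d) * (b * c) *+ 4)).
    by rewrite lerMn2r zw2_le orbT.
  rewrite -subr_ge0.
  have -> : (a * d + b * c) ^+ 2 - a * d * (b * c) *+ 4 = (a * d - b * c) ^+ 2.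
    by rewrite -mulr_natr; ring.
  by rewrite real_exprn_even_ge0// realB// ger0_real.
have -> : (a + b) * (c + d) = a * c + (a * d + b * c) + b * d by ring.
by rewrite sqrrD; apply: lerD => //; apply: lerD.
Qed.

(** * The Krein norm and adjoints into a Krein space *)

Section Krein.
Variables (R : realType).

Lemma hilbert_subspace_cauchy_schwarz (F : lmodType R[i]) (f : F -> F -> R[i])
    (S : set F) (x y : F) : hilbert_subspace f S -> S x -> S y ->
  0 <= f x x /\ `|f x y| ^+ 2 <= f x x * f y y.
Proof.
move=> [G [j [_ <- fj]]] [u _ <-] [v _ <-]; rewrite !fj.
by split; [exact: dnorm_ge0|exact: dot_cauchy_schwarz].
Qed.

Variable K : kreinSpace R.

Lemma krein_decompP :
  fundamental_decomposition (kform K) (krein_decomp K).1 (krein_decomp K).2.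
Proof. exact: svalP (cid (krein_decomposable K)). Qed.

Lemma krein_partsP (x : K) :
  (krein_decomp K).1 (krein_pos x) /\ (krein_decomp K).2 (krein_neg x).
Proof.
have [_ _ _ + _] := krein_decompP => /(_ x)[p [n [Pp Nn xE]]].
apply: (@xgetPex _ 0
  [set q | (krein_decomp K).1 q /\ (krein_decomp K).2 (x - q)]).
exists p; split => //; by rewrite xE addrC addKr.
Qed.

Lemma krein_pos_ge0 (x : K) : 0 <= kform K (krein_pos x) (krein_pos x).
Proof.
have [Kp _ _ _ _] := krein_decompP; have [xp _] := krein_partsP x.
by have [] := hilbert_subspace_cauchy_schwarz Kp xp xp.
Qed.

Lemma krein_neg_le0 (x : K) : 0 <= - kform K (krein_neg x) (krein_neg x).
Proof.
have [_ Kn _ _ _] := krein_decompP; have [_ xn] := krein_partsP x.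
by have [] := hilbert_subspace_cauchy_schwarz Kn xn xn.
Qed.

Lemma krein_norm_ge0 (x : K) : 0 <= krein_norm x.
Proof. by rewrite sqrtC_ge0 addr_ge0 ?krein_pos_ge0 ?krein_neg_le0. Qed.

Lemma krein_form_le (x y : K) :
  `|kform K x y| <= krein_norm x * krein_norm y.
Proof.
have [Kp Kn Kpn _ _] := krein_decompP.
have [xp xn] := krein_partsP x; have [yp yn] := krein_partsP y.
have [_ pos_le] := hilbert_subspace_cauchy_schwarz Kp xp yp.
have [_ neg_le] := hilbert_subspace_cauchy_schwarz Kn xn yn.
(* Both cross terms vanish by orthogonality of the summands, one of them through Hermitian
   symmetry. *)
have -> : kform K x y = kform K (krein_pos x) (krein_pos y) +
    kform K (krein_neg x) (krein_neg y).
  have xE : x = krein_pos x + krein_neg x by rewrite addrC subrK.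
  have yE : y = krein_pos y + krein_neg y by rewrite addrC subrK.
  have formD p n p' n' : kform K p n' = 0 -> kform K n p' = 0 ->
      kform K (p + n) (p' + n') = kform K p p' + kform K n n'.
    by move=> pn np; rewrite linearDl/= !linearDr/= pn np addr0 add0r.
  rewrite {1}xE {1}yE formD//; first exact: Kpn.
  by rewrite hermC Kpn// rmorph0 mulr0.
apply: cauchy_schwarz_add; rewrite ?krein_pos_ge0 ?krein_neg_le0//.
by rewrite normrN in neg_le.
Qed.

Variables (H : hilbertSpace R) (T : H -> K).

Lemma krein_adjoint_exists : bounded_to_krein T ->
  exists S : K -> H, is_krein_adjoint T S.
Proof.
move=> [T_lin [M T_le]].
have form_le x y : `|kform K (T x) y| <= `|M|%:C%C * krein_norm y * `|x|.
  apply: le_trans (krein_form_le _ _) _.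
  rewrite mulrAC ler_wpM2r ?krein_norm_ge0// (le_trans (T_le _))//.
  by rewrite ler_wpM2r// lecR ler_norm.
have /choice[S SE] y : exists u : H, forall x, kform K (T x) y = inner H x u.
  apply: (@riesz_representation _ _ _ (`|M| * complex.Re (krein_norm y))).
    by move=> a u v /=; rewrite T_lin linearPl.
  move=> x; rewrite rmorphM/= RRe_real ?ger0_real ?krein_norm_ge0//.
exists S; split; last by move=> x y; rewrite SE.
split.
  move=> a u v; apply: inner_cancel => z.
  by rewrite -SE !linearPr/= !SE.
(* Here [|S y|^2 = [T (S y), y]] is at most [|M| * krein_norm y * |S y|]; cancel [|S y|] when it is
   nonzero. The absolute value of [M] keeps the bound nonnegative when [S y = 0]. *)
exists `|M| => y; have [->|Sy_neq0] := eqVneq (S y) 0.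
  by rewrite normr0 mulr_ge0 ?krein_norm_ge0// ler0c.
rewrite -(ler_pM2r (x := `|S y|)) ?normr_gt0// -expr2 inner_norm -SE.
by rewrite (le_trans _ (form_le _ _))// real_ler_norm// ger0_real// SE dnorm_ge0.
Qed.

Lemma krein_adjointP : bounded_to_krein T ->
  is_krein_adjoint T (krein_adjoint T).
Proof.
move=> /krein_adjoint_exists TS.
exact: (@xgetPex _ _ [set S | is_krein_adjoint T S]).
Qed.

Lemma krein_adjoint_comp_bounded : bounded_to_krein T ->
  bounded_operator (fun x : H => `|x|) (fun x : H => `|x|)
    (fun x => krein_adjoint T (T x)).
Proof.
move=> T_bounded; have [[S_lin [M' S_le]] _] := krein_adjointP T_bounded.
have [T_lin [M T_le]] := T_bounded.
split; first by move=> a u v; rewrite T_lin S_lin.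
exists (`|M'| * M) => x; apply: le_trans (S_le _) _.
apply: (@le_trans _ _ (`|M'|%:C%C * krein_norm (T x))).
  by rewrite ler_wpM2r ?krein_norm_ge0// lecR ler_norm.
by rewrite rmorphM/= -mulrA ler_wpM2l// ler0c.
Qed.

End Krein.

(** * Minimisers of the quadratic functional *)

Theorem proposition3p3 (R : realType) (H : hilbertSpace R)
    (K E : kreinSpace R) (T : H -> K) (V : H -> E) (rho : R) (z0 : E)
    (H_separable : separable H)
    (T_bounded : bounded_to_krein T) (T_surj : range T = setT)
    (V_bounded : bounded_to_krein V) (V_surj : range V = setT)
    (VV_indefinite : indefinite (fun x => krein_adjoint V (V x)))
    (rho_neq0 : rho != 0) :
  let J x := kform K (T x) (T x) + rho%:C%C * kform E (V x - z0) (V x - z0) in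
  let A x := krein_adjoint T (T x) + rho%:C%C *: krein_adjoint V (V x) in
  (exists x0 : H, forall x : H, J x0 <= J x) <->
  bounded_positive A /\ range A (krein_adjoint V z0).
Proof.
move=> J A.
have [_ T_adj] := krein_adjointP T_bounded.
have [_ V_adj] := krein_adjointP V_bounded.
have [T_lin _] := T_bounded; have [V_lin _] := V_bounded.
have [TT_lin [MT TT_le]] := krein_adjoint_comp_bounded T_bounded.
have [VV_lin [MV VV_le]] := krein_adjoint_comp_bounded V_bounded.
set w := krein_adjoint V z0.
have conj_rho : rho%:C%C^* = rho%:C%C by rewrite (CrealP _)// complex_real.
have rho_neq0' : rho%:C%C != 0 by rewrite (inj_eq (@complexI _)).
have conj_inner x y : (inner H x y)^* = inner H y x.
  by rewrite [RHS]hermC expr0 mul1r.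
have conj_form (L : kreinSpace R) (x y : L) : (kform L x y)^* = kform L y x.
  by rewrite [RHS]hermC expr0 mul1r.
have A_lin : linear A.
  move=> a u v; rewrite /A TT_lin VV_lin !scalerDr !scalerA [_ * a]mulrC.
  by rewrite addrACA.
have innerZl a x y : inner H (a *: x) y = a * inner H x y.
  by rewrite linearZl_LR.
have innerZr a x y : inner H x (a *: y) = a^* * inner H x y.
  by rewrite linearZr_LR.
have A_inner x y : inner H (A x) y =
    kform K (T x) (T y) + rho%:C%C * kform E (V x) (V y).
  rewrite /A linearDl/= innerZl -!(conj_inner y) -T_adj -V_adj.
  by rewrite !conj_form.
have w_inner y : inner H w y = kform E z0 (V y).
  by rewrite -conj_inner -V_adj conj_form.
(* Twice the real part is written as a sum of conjugates, so that the identity stays in [R[i]]. *)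
have J_add x h : J (x + h) = J x +
    (inner H (A x - rho%:C%C *: w) h + (inner H (A x - rho%:C%C *: w) h)^*) +
    inner H (A h) h.
  have TD : T (x + h) = T x + T h by have := T_lin 1 x h; rewrite !scale1r.
  have VD : V (x + h) - z0 = (V x - z0) + V h.
    by have := V_lin 1 x h; rewrite !scale1r addrAC => ->.
  rewrite /J TD hnormD VD hnormD expr0 !mul1r.
  rewrite [inner H (A x - _) h]linearBl/= innerZl w_inner.
  rewrite !A_inner [kform E (V x - z0) (V h)]linearBl/=.
  rewrite !(rmorphD, rmorphN, rmorphM)/= conj_rho.
  ring.
have A_scale (a : R[i]) x : A (a *: x) = a *: A x.
  have A0 : A 0 = 0.
    by apply: (addrI (A 0)); have := A_lin 1 0 0; rewrite !scale1r !addr0 => <-.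
  by have := A_lin a x 0; rewrite A0 !addr0.
split=> [[x0 x0_min]|[[_ A_ge0] [u _ Au]]].
  have first_order h : 0 <= inner H (A h) h /\
      inner H (A x0 - rho%:C%C *: w) h +
      (inner H (A x0 - rho%:C%C *: w) h)^* = 0.
    (* For real [t], conjugation fixes [t], so the increment of [J] along [t *: h] is a quadratic
       polynomial in [t]. *)
    apply: real_quadratic_ge0 => t /CrealP t_real.
    have := x0_min (x0 + t *: h); rewrite J_add -addrA lerDl.
    rewrite A_scale innerZl !innerZr rmorphM/= !t_real.
    by rewrite expr2 mulrDr mulrA.
  split; last first.
    exists (rho%:C%C^-1 *: x0) => //; rewrite A_scale.
    (* Only the real part of the gradient pairing is known to vanish; testing with the gradient
       itself turns it into a squared norm. *)
    have [_] := first_order (A x0 - rho%:C%C *: w).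
    rewrite conj_inner -mulr2n => /eqP; rewrite mulrn_eq0/= dnorm_eq0 subr_eq0.
    by move=> /eqP ->; rewrite scalerA mulVf// scale1r.
  split; last by move=> x; have [] := first_order x.
  split=> //; exists (MT + `|rho| * MV) => x.
  rewrite (le_trans (ler_normD _ _))// rmorphD/= mulrDl lerD ?TT_le//.
  rewrite normrZ rmorphM/= -mulrA normc_def/= expr0n addr0 sqrtr_sqr.
  by rewrite ler_wpM2l ?ler0c.
(* The gradient [A (rho *: u) - rho *: w] vanishes, so the increment of [J] from this point is just
   [inner H (A h) h]. *)
exists (rho%:C%C *: u) => x.
rewrite -[x](subrK (rho%:C%C *: u)) addrC J_add A_scale Au subrr.
by rewrite linear0l conjC0 !addr0 lerDl.
Qed.
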